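(* Let $G$ be a connected bipartite graph with $n$ vertices and $m$ edges, with $n\geq 2$. Then $$EE(G)\geq 2\cosh\left(\frac{2m}{n}\right)+(n-2).$$ Equality holds if and only if $G$ is isomorphic to $K_{\sqrt{m},\sqrt{m}}$, with $2\sqrt{m}=n$.
   Context: Graphs are finite, simple and undirected. For a graph $G$ with vertex set $\{1,\dots,n\}$, the adjacency matrix $A(G)$ is the symmetric $n\times n$ matrix with entry $1$ in position $(i,j)$ if $ij$ is an edge and $0$ otherwise; its eigenvalues (with multiplicity) are $\lambda_1\geq\dots\geq\lambda_n$. The Estrada index of $G$ is $EE(G)=\sum_{i=1}^n e^{\lambda_i}$. A graph is bipartite if its vertex set can be partitioned into two disjoint nonempty sets $V_1,V_2$ such that every edge has one end vertex in $V_1$ and the other in $V_2$. $K_{p,q}$ denotes the complete bipartite graph with parts of sizes $p$ and $q$. *)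

(* Defs.v *)
From mathcomp Require Import all_boot all_order all_algebra.
From mathcomp Require Import polyrcf reals sequences exp.

Set Implicit Arguments.
Unset Strict Implicit.
Unset Printing Implicit Defensive.

Import Order.TTheory GRing.Theory Num.Theory.

Local Open Scope ring_scope.

Definition simple_graph (V : finType) (e : rel V) : Prop :=
  symmetric e /\ irreflexive e.

Definition edges (V : finType) (e : rel V) : {set {set V}} :=
  [set [set x; y] | x in V, y in e x].

Definition connected_graph (V : finType) (e : rel V) : Prop :=
  forall x y : V, connect e x y.

Definition bipartite (V : finType) (e : rel V) : Prop :=
  exists V1 V2 : {set V},
    [/\ V1 != set0, V2 != set0, [disjoint V1 & V2], V1 :|: V2 = [set: V]
      & forall x y, e x y ->
          (x \in V1 /\ y \in V2) \/ (x \in V2 /\ y \in V1)].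

Definition graph_iso (V W : finType) (e : rel V) (f : rel W) : Prop :=
  exists2 h : V -> W, bijective h & forall x y, f (h x) (h y) = e x y.

Definition complete_bipartite (p q : nat) : rel ('I_p + 'I_q)%type :=
  fun x y => match x, y with
             | inl _, inr _ | inr _, inl _ => true
             | _, _ => false
             end.

Definition adjmx (R : realType) (n : nat) (e : rel 'I_n) : 'M[R]_n :=
  \matrix_(i < n, j < n) (e i j)%:R.

(* The real eigenvalues of A in non-increasing order, each repeated according
   to its algebraic multiplicity; [rootsR] is increasing and duplicate-free.
   For symmetric A, such as an adjacency matrix, these are all n eigenvalues. *)
Definition eigenvalues (R : realType) (n : nat) (A : 'M[R]_n) : seq R :=
  flatten [seq nseq (mup x (char_poly A)) x | x <- rev (rootsR (char_poly A))].

Definition estrada_index (R : realType) (n : nat) (e : rel 'I_n) : R :=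
  \sum_(x <- eigenvalues (adjmx R e)) expR x.

Definition cosh (R : realType) (x : R) : R := (expR x + expR (- x)) / 2.

(* Main.v *)
Require Import Defs.
From mathcomp Require Import all_boot all_order all_algebra.
From mathcomp Require Import polyrcf reals sequences exp.
From mathcomp Require Import complex zify ring lra.

(* Since the spectrum of a bipartite graph is symmetric about 0,
   EE(G) = sum_i cosh(lambda_i). The Rayleigh quotient of the all-ones vector
   gives an eigenvalue lambda >= 2m/n; it comes paired with -lambda, and each of
   the other n - 2 terms is at least cosh 0 = 1. In the equality case the
   spectrum is {2m/n, -2m/n, 0, ..., 0}: the all-ones vector is then an
   eigenvector, so G is regular, and tr A^2 = 2m forces n^2 = 4m, so that every
   vertex has degree n/2 and G is complete bipartite with equal parts.
   Conversely, the adjacency matrix of K_{p,p} satisfies A^3 = p^2 A, so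
   cosh(lambda) = 1 + (cosh p - 1) lambda^2 / p^2 on its spectrum, and
   summing only requires tr A^2 = 2m. *)

Import Num.Def.
Import Order.TTheory GRing.Theory Num.Theory.

Local Open Scope ring_scope.

Set Implicit Arguments.
Unset Strict Implicit.

(** * Characteristic polynomials and spectra of symmetric matrices *)

Lemma char_poly_conj (R : comNzRingType) n (P Q A : 'M[R]_n) :
  Q *m P = 1%:M -> char_poly (Q *m A *m P) = char_poly A.
Proof.
move=> QP; rewrite /char_poly.
have QPX : map_mx polyC Q *m map_mx polyC P = 1%:M by rewrite -map_mxM QP map_mx1.
have -> : char_poly_mx (Q *m A *m P) =
    map_mx polyC Q *m char_poly_mx A *m map_mx polyC P.
  rewrite /char_poly_mx !map_mxM mulmxBr mulmxBl; congr (_ - _).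
  by rewrite scalar_mxC -mulmxA QPX mulmx1.
by rewrite !det_mulmx mulrAC -det_mulmx QPX det1 mul1r.
Qed.

(** Pulling -1 out of each of the n rows of [X + A] gives [(-1)^n] times the characteristic
    polynomial of [A] at [-X]; the n signs are then absorbed one per linear factor. *)
Lemma char_poly_opp (R : comNzRingType) n (A : 'M[R]_n) (s : seq R) :
  size s = n -> char_poly A = \prod_(x <- s) ('X - x%:P) ->
  char_poly (- A) = \prod_(x <- map -%R s) ('X - x%:P).
Proof.
move=> sz_s pA.
have -> : char_poly (- A) = (-1) ^+ n * (char_poly A \Po - 'X).
  rewrite /char_poly -det_map_mx -detZ.
  congr (\det _); apply/matrixP=> i j; rewrite !mxE.
  rewrite rmorphB /= comp_polyC rmorphMn /= comp_polyX.
  by rewrite mulN1r opprB polyCN mulNrn !opprK addrC.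
rewrite pA -sz_s; elim: s {sz_s pA} => [|x s IHs] /=.
  by rewrite !big_nil mul1r rmorph1.
rewrite !big_cons -IHs exprS rmorphM /= rmorphB /= comp_polyX comp_polyC.
by rewrite polyCN mulrACA; congr (_ * _); rewrite mulN1r opprB !opprK addrC.
Qed.

Local Notation toC := (real_complex _).

(* [c i] is the squared modulus of the [i]-th coordinate of [v] in an orthonormal
   (complex) eigenbasis of [A]. *)
Lemma symmetric_spectrum (R : rcfType) n (A : 'M[R]_n) : A^T = A ->
  exists d : 'I_n -> R,
  [/\ char_poly A = \prod_i ('X - (d i)%:P),
      forall k, \tr (A ^+ k) = \sum_i d i ^+ k
    & forall v : 'rV[R]_n, exists2 c : 'I_n -> R, forall i, 0 <= c i
        & forall k, (v *m A ^+ k *m v^T) 0 0 = \sum_i c i * d i ^+ k].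
Proof.
move=> symA.
(* Over [R[i]] the matrix is Hermitian, so it is unitarily diagonalizable with real eigenvalues;
   injectivity of the embedding of [R] brings the identities back. *)
pose AC : 'M[R[i]]_n := map_mx toC A.
have conjE (x : R) : (toC x)^* = toC x by apply/CrealP/complex_realP; exists x.
have AC_herm : AC \is hermsymmx.
  apply: realsym_hermsym.
    apply/is_hermitianmxP; rewrite expr0 scale1r map_mx_id //.
    by rewrite /AC map_trmx symA.
  by apply/mxOverP => i j; rewrite mxE; apply/complex_realP; eexists.
have /orthomx_spectralP := hermitian_normalmx AC_herm.
have := hermitian_spectral_diag_real AC_herm.
have := spectral_unitarymx AC.
move: (spectralmx AC) (spectral_diag AC) => P D Pu /mxOverP Dreal ACE.
pose d i := complex.Re (D 0 i).
have dE i : D 0 i = toC (d i) by rewrite /d RRe_real.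
have PVP : invmx P *m P = 1%:M by rewrite mulVmx ?unitarymx_unit.
have PPV : P *m invmx P = 1%:M by rewrite mulmxV ?unitarymx_unit.
have powE k : map_mx toC (A ^+ k) =
    invmx P *m diag_mx (\row_i toC (d i ^+ k)) *m P.
  elim: k => [|k IHk].
    rewrite expr0 map_mx1; set D1 := diag_mx _.
    have -> : D1 = 1%:M.
      by apply/matrixP => i j; rewrite !mxE expr0 rmorph1.
    by rewrite mulmx1.
  have -> : A ^+ k.+1 = A *m A ^+ k by exact: exprS.
  rewrite map_mxM IHk -/AC ACE -!mulmxA (mulmxA P) PPV mul1mx.
  rewrite (mulmxA (diag_mx D)) mulmx_diag.
  congr (_ *m (diag_mx _ *m _)); apply/rowP => i.
  by rewrite !mxE dE exprS rmorphM.
exists d; split.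
- apply: (@map_poly_inj _ _ (real_complex R)).
  rewrite map_char_poly -/AC ACE char_poly_conj //.
  rewrite char_poly_trig ?diag_mx_is_trig //.
  rewrite rmorph_prod; apply: eq_bigr => i _.
  by rewrite mxE eqxx dE rmorphB /= map_polyX map_polyC.
- move=> k; apply: (@complexI R); rewrite -trace_map_mx powE.
  rewrite mxtrace_mulC mulmxA PPV mul1mx mxtrace_diag rmorph_sum.
  by apply: eq_bigr => i _; rewrite mxE.
move=> v; pose w : 'rV[R[i]]_n := map_mx toC v *m invmx P.
have wE i : w 0 i * (w 0 i)^* = toC (complex.Re (`|w 0 i| ^+ 2)).
  by rewrite -normCK RRe_real // rpredX // normr_real.
exists (fun i => complex.Re (`|w 0 i| ^+ 2)).
  by move=> i; rewrite -lecR -wE mul_conjC_ge0.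
move=> k; apply: (@complexI R).
(* [P] is unitary, so [P v^T] is the conjugate transpose of [w = v P^-1]. Hence [v A^k v^T] is the
   sum of [|w_i|^2 d_i^k]. *)
have vT : P *m map_mx toC v^T = \col_i (w 0 i)^*.
  apply/colP => i; rewrite !mxE rmorph_sum; apply: eq_bigr => j _.
  rewrite invmx_unitary ?mxE ?rmorphM //= -[RHS]/(conjC _ * conjC _).
  by rewrite conjE conjCK mulrC.
have <- : (map_mx toC (v *m A ^+ k *m v^T)) 0 0 = toC ((v *m A ^+ k *m v^T) 0 0).
  by rewrite [LHS]mxE.
rewrite !map_mxM powE !mulmxA -/w -!mulmxA vT mulmxA mxE rmorph_sum.
apply: eq_bigr => i _.
rewrite -/w mul_diag_mx mxE ![(\row__ _) _ _]mxE ![(\col__ _) _ _]mxE.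
by rewrite mulrCA wE mulrC -rmorphM.
Qed.

(** Multiplicities are compared value by value: as [rootsR] has no duplicates, each root contributes
    exactly one block, whose length is its multiplicity in the product. *)
Lemma perm_eigenvalues (R : realType) n (A : 'M[R]_n) (s : seq R) :
  char_poly A = \prod_(x <- s) ('X - x%:P) -> perm_eq (eigenvalues A) s.
Proof.
move=> pA; apply/allP => x _ /=; apply/eqP; rewrite -(mu_prod_XsubC x s) -pA.
have p0 : char_poly A != 0 by rewrite monic_neq0 ?char_poly_monic.
rewrite /eigenvalues count_flatten -map_comp sumnE big_map.
under eq_bigr do rewrite /= count_nseq /=.
have [x_root|x_root] := boolP (x \in rev (rootsR (char_poly A))).
  rewrite (bigD1_seq x) ?rev_uniq ?uniq_roots //= eqxx mul1n.
  by rewrite big1 ?addn0 // => y /negPf->.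
rewrite big1_seq => [|y /andP[_ y_root]].
  rewrite mupNroot //; apply: contra x_root; rewrite mem_rev.
  by have := roots_on_rootsR p0 x; rewrite inE /= => ->.
by case: eqP y_root x_root => // -> ->.
Qed.

(** * Monotonicity and minimum of the hyperbolic cosine *)

Lemma coshN (R : realType) (x : R) : cosh (- x) = cosh x.
Proof. by rewrite /cosh opprK addrC. Qed.

Lemma cosh0 (R : realType) : cosh 0 = 1 :> R.
Proof. by rewrite /cosh oppr0 expR0; field. Qed.

Lemma ltr_cosh (R : realType) (x y : R) : 0 <= x -> x < y -> cosh x < cosh y.
Proof.
move=> x0 xy; have ex : expR x < expR y by rewrite ltr_expR.
have exy : expR (- x - y) < 1 by rewrite expR_lt1; lra.
(* This product expands to [2 (cosh y - cosh x)]. *)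
have : 0 < (expR y - expR x) * (1 - expR (- x - y)) by apply: mulr_gt0; lra.
have expyE : (expR y - expR x) * expR (- x - y) = expR (- x) - expR (- y).
  rewrite mulrBl -!expRD; congr (expR _ - expR _); ring.
by rewrite mulrBr mulr1 expyE /cosh; lra.
Qed.

Lemma cosh_gt1 (R : realType) (x : R) : x != 0 -> 1 < cosh x.
Proof.
move=> x0; rewrite -(cosh0 R); have [xlt|xgt] := ltP x 0.
  by rewrite -[cosh x]coshN ltr_cosh // oppr_gt0.
by rewrite ltr_cosh // lt_def x0.
Qed.

Lemma cosh_ge1 (R : realType) (x : R) : 1 <= cosh x.
Proof. by have [->|/cosh_gt1/ltW//] := eqVneq x 0; rewrite cosh0. Qed.

(** * Edge counting and the symmetric spectrum of a bipartite graph *)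

Lemma handshake (V : finType) (e : rel V) : simple_graph e ->
  (\sum_x \sum_y e x y)%N = (2 * #|edges e|)%N.
Proof.
move=> [e_sym e_irr]; pose E := [set p | e p.1 p.2].
have -> : edges e = [set [set p.1; p.2] | p in E].
  apply/setP => A; apply/imset2P/imsetP.
    by case=> x y _ exy ->; exists (x, y); rewrite ?inE.
  by case=> -[x y]; rewrite inE /= => exy ->; exists x y.
transitivity #|E|.
  rewrite -sum1_card pair_big [RHS]big_mkcond; apply: eq_bigr => p _ /=.
  by rewrite inE; case: (e _ _).
(* Ordered adjacent pairs are grouped by underlying edge; the fibre over [[set x; y]] is
   [[set (x, y); (y, x)]], of size two because [e] is irreflexive. *)
rewrite -sum1_card (partition_big_imset (fun p => [set p.1; p.2])) /=.
rewrite mulnC -sum_nat_const; apply: eq_bigr => A /imsetP[[x y]].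
rewrite inE /= => exy -> {A}.
have xy : x != y by apply: contraTneq exy => ->; rewrite e_irr.
rewrite (eq_bigl (mem [set (x, y); (y, x)])) ?sum1_card ?cards2 ?xpair_eqE.
  by rewrite (negPf xy).
case=> a b; rewrite /= !inE !xpair_eqE /=.
apply/andP/orP => [[eab /eqP abE]|].
  have ab : a != b by apply: contraTneq eab => ->; rewrite e_irr.
  have := set21 a b; have := set22 a b; rewrite abE !inE; move: ab.
  have [->|_] := eqVneq b x; first by move=> /negPf-> _ /= ->; right.
  have [->|_] //= := eqVneq b y.
  by move=> /negPf ay _; rewrite ay orbF => ->; left.
by case=> /andP[/eqP-> /eqP->]; rewrite ?exy ?(e_sym y) ?exy ?eqxx // setUC.
Qed.

Lemma bipartite_adjmx_opp (R : realType) n (e : rel 'I_n) : bipartite e ->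
  exists2 S : 'M[R]_n, S *m S = 1%:M & S *m adjmx R e *m S = - adjmx R e.
Proof.
case=> V1 [V2 [_ _ V12 _ eV]].
(* The signature matrix, -1 on [V1] and 1 on [V2]: conjugation multiplies entry (i, j) by the
   product of the two signs, which is -1 on every edge. *)
exists (diag_mx (\row_i (-1) ^+ (i \in V1))).
  apply/matrixP => i j; rewrite mul_diag_mx !mxE.
  by rewrite mulrnAr -expr2 sqrr_sign.
apply/matrixP => i j; rewrite mul_mx_diag mxE mul_diag_mx !mxE.
have [eij|] := boolP (e i j); last by rewrite mulr0 mul0r oppr0.
rewrite mulr1 -signr_addb.
have V2N k : k \in V2 -> (k \in V1) = false by move=> ?; rewrite (disjointFl V12).
by have [[-> /V2N->]|[/V2N-> ->]] := eV _ _ eij.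
Qed.

(** [A] and [-A] are similar, so they share a characteristic polynomial, and its splitting into
    linear factors is unique up to order. *)
Lemma bipartite_spectrum (R : realType) n (e : rel 'I_n) (d : 'I_n -> R) :
  bipartite e -> char_poly (adjmx R e) = \prod_i ('X - (d i)%:P) ->
  perm_eq [seq - x | x <- codom d] (codom d).
Proof.
move=> e_bip pA; have [S SS SAS] := bipartite_adjmx_opp R e_bip.
have pA' : char_poly (adjmx R e) = \prod_(x <- codom d) ('X - x%:P).
  by rewrite pA big_map enumT.
apply: prod_XsubC_eq; rewrite -pA' -(char_poly_opp _ pA') ?size_codom ?card_ord //.
by rewrite -SAS char_poly_conj.
Qed.

Lemma estrada_index_cosh (R : realType) n (e : rel 'I_n) (d : 'I_n -> R) :
  bipartite e -> char_poly (adjmx R e) = \prod_i ('X - (d i)%:P) ->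
  estrada_index R e = \sum_i cosh (d i).
Proof.
move=> e_bip pA; have perm_d := bipartite_spectrum e_bip pA.
have -> : estrada_index R e = \sum_i expR (d i).
  rewrite /estrada_index (perm_big (codom d)) ?big_map ?enumT //=.
  by apply: perm_eigenvalues; rewrite pA big_map enumT.
have sumN : \sum_i expR (- d i) = \sum_i expR (d i).
  have := perm_big _ perm_d (R := R) (op := +%R) (x := 0) (P := xpredT) (F := expR).
  by rewrite !big_map -enumT !big_enum.
rewrite /cosh -mulr_suml big_split /= sumN.
by move: (\sum_i _) => S; field.
Qed.

(** * Averaging, and the lower bound for a sum of cosh over a symmetric spectrum *)

Lemma weighted_sum_ge (R : realFieldType) (I : finType) (c d : I -> R) (mu : R) :
    (forall i, 0 <= c i) -> 0 < \sum_i c i ->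
    \sum_i c i * d i = mu * \sum_i c i ->
  exists i, mu <= d i.
Proof.
move=> c0 sc scd; apply/existsP; apply: contraTT sc.
rewrite negb_exists => /forallP d_lt.
have {}d_lt i : 0 < mu - d i by rewrite subr_gt0 ltNge.
have /psumr_eq0P c_eq0 : \sum_i c i * (mu - d i) = 0.
  under eq_bigr do rewrite mulrBr.
  by rewrite sumrB -mulr_suml scd mulrC subrr.
rewrite big1 ?ltxx // => i _; apply/eqP.
have /eqP := c_eq0 (fun i _ => mulr_ge0 (c0 i) (ltW (d_lt i))) i isT.
by rewrite mulf_eq0 (gt_eqF (d_lt i)) orbF.
Qed.

Lemma sum_cosh_ge (R : realType) (n : nat) (d : 'I_n -> R) (mu : R) :
    perm_eq [seq - x | x <- codom d] (codom d) -> 0 < mu ->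
    (exists i, mu <= d i) ->
  2 * cosh mu + (n%:R - 2) <= \sum_i cosh (d i)
  /\ (\sum_i cosh (d i) = 2 * cosh mu + (n%:R - 2) ->
      exists i j, [/\ i != j, d i = mu, d j = - mu
        & forall k, k != i -> k != j -> d k = 0]).
Proof.
move=> dN mu0 [i di]; have /codomP[j dj] : - d i \in codom d.
  by rewrite -(perm_mem dN) map_f ?codom_f.
have ij : i != j by apply/eqP => ij; move: dj di; rewrite -ij; lra.
have cmu : cosh mu <= cosh (d i).
  by move: di; rewrite le_eqVlt => /orP[/eqP->//|/ltr_cosh/ltW->//]; exact: ltW.
(* The excess over the bound is split into two nonnegative pieces: one from the pair [d i],
   [d j = - d i], one from all other indices. Equality makes both vanish. *)
have -> : \sum_i cosh (d i) = 2 * cosh mu + (n%:R - 2)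
   + (2 * (cosh (d i) - cosh mu)
      + \sum_(k | (k != i) && (k != j)) (cosh (d k) - 1)).
  have sumD (F : 'I_n -> R) :
      \sum_k F k = F i + (F j + \sum_(k | (k != i) && (k != j)) F k).
    by rewrite (bigD1 i) // (bigD1 j) // eq_sym.
  have nE : (n%:R : R) = \sum_(k < n) 1 by rewrite sumr_const card_ord.
  by rewrite nE !sumD -dj coshN sumrB; ring.
have c0 k : 0 <= cosh (d k) - 1 by rewrite subr_ge0 cosh_ge1.
have sc0 : 0 <= \sum_(k | (k != i) && (k != j)) (cosh (d k) - 1).
  by apply: sumr_ge0.
split=> [|eq_cosh]; first by lra.
have dimu : d i = mu.
  apply/eqP; move: di; rewrite le_eqVlt eq_sym => /orP[//|/ltr_cosh].
  by move=> /(_ (ltW mu0)) ?; exfalso; lra.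
exists i, j; split=> //; first by rewrite -dj dimu.
have /psumr_eq0P sc : \sum_(k | (k != i) && (k != j)) (cosh (d k) - 1) = 0 by lra.
move=> k ki kj; apply/eqP; apply: contraT => /cosh_gt1.
by have := sc (fun k _ => c0 k) k; rewrite ki kj => /(_ isT); lra.
Qed.

(** * Moments of the adjacency matrix at the all-ones vector, and regularity *)

Lemma tr_adjmx (R : realType) n (e : rel 'I_n) :
  simple_graph e -> (adjmx R e)^T = adjmx R e.
Proof. by case=> e_sym _; apply/matrixP => i j; rewrite !mxE e_sym. Qed.

Lemma sum_adjmx (R : realType) n (e : rel 'I_n) :
  simple_graph e -> \sum_i \sum_j adjmx R e i j = 2 * #|edges e|%:R.
Proof.
move=> e_simple; rewrite -natrM -handshake // natr_sum; apply: eq_bigr => i _.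
by rewrite natr_sum; apply: eq_bigr => j _; rewrite mxE.
Qed.

Lemma mxtrace_adjmx2 (R : realType) n (e : rel 'I_n) :
  simple_graph e -> \tr (adjmx R e ^+ 2) = 2 * #|edges e|%:R.
Proof.
move=> e_simple; rewrite -sum_adjmx // /mxtrace; apply: eq_bigr => i _.
rewrite expr2 -mulmxE mxE; apply: eq_bigr => j _.
by rewrite -{2}tr_adjmx // !mxE; case: (e i j); rewrite ?mulr1 ?mulr0.
Qed.

Lemma ones_mul_adjmx (R : realType) n (e : rel 'I_n) j :
  ((const_mx 1 : 'rV[R]_n) *m adjmx R e) 0 j = \sum_i adjmx R e i j.
Proof. by rewrite mxE; apply: eq_bigr => i _; rewrite mxE mul1r. Qed.

Lemma ones_sqnorm (R : realType) n :
  let u := const_mx 1 : 'rV[R]_n in (u *m u^T) 0 0 = n%:R.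
Proof.
move=> u; rewrite mxE (eq_bigr (fun=> 1)) ?sumr_const ?card_ord // => i _.
by rewrite !mxE mulr1.
Qed.

Lemma ones_adjmx (R : realType) n (e : rel 'I_n) : simple_graph e ->
  let u := const_mx 1 : 'rV[R]_n in (u *m adjmx R e *m u^T) 0 0 = 2 * #|edges e|%:R.
Proof.
move=> e_simple u; rewrite -sum_adjmx // mxE exchange_big /=.
apply: eq_bigr => j _.
by rewrite ones_mul_adjmx !mxE mulr1.
Qed.

Lemma ones_adjmx2 (R : realType) n (e : rel 'I_n) : simple_graph e ->
  let u := const_mx 1 : 'rV[R]_n in
  (u *m adjmx R e ^+ 2 *m u^T) 0 0 = \sum_j (\sum_i adjmx R e i j) ^+ 2.
Proof.
move=> e_simple u; set A := adjmx R e.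
have -> : u *m A ^+ 2 *m u^T = (u *m A) *m (u *m A)^T.
  by rewrite trmx_mul tr_adjmx // expr2 -mulmxE !mulmxA.
by rewrite mxE; apply: eq_bigr => j _; rewrite [_^T _ _]mxE !ones_mul_adjmx.
Qed.

(** The weights [c] of the all-ones vector [u] give the [d i] the mean [mu], which is also an upper
    bound; so [c] is supported where [d i = mu], and [u] is an eigenvector for [mu]. Its coordinates
    then say that all degrees equal [mu]. *)
Lemma regular_of_top_eigenvalue (R : realType) n (e : rel 'I_n) (d : 'I_n -> R)
    (mu : R) :
    simple_graph e -> mu * n%:R = 2 * #|edges e|%:R ->
    (forall v : 'rV[R]_n, exists2 c : 'I_n -> R, forall i, 0 <= c i
        & forall k, (v *m adjmx R e ^+ k *m v^T) 0 0 = \sum_i c i * d i ^+ k) ->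
    (forall i, d i <= mu) ->
  forall j, \sum_i adjmx R e i j = mu.
Proof.
move=> e_simple muE specA d_le; have [c c0 cE] := specA (const_mx 1).
have c_sum : \sum_i c i = n%:R.
  rewrite -(ones_sqnorm R n); have := cE 0%N.
  by rewrite expr0 mulmx1 => ->; apply: eq_bigr => i _; rewrite expr0 mulr1.
have cd_sum : \sum_i c i * d i = 2 * #|edges e|%:R.
  by rewrite -ones_adjmx //; have := cE 1%N; rewrite expr1 => ->.
have := cE 2%N; rewrite ones_adjmx2 // => cd2_sum.
have /psumr_eq0P cd_eq0 : \sum_i c i * (mu - d i) = 0.
  under eq_bigr do rewrite mulrBr.
  by rewrite sumrB -mulr_suml c_sum cd_sum -muE mulrC subrr.
have {}cd_eq0 i : c i * (mu - d i) = 0.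
  by apply: cd_eq0 => // k _; rewrite mulr_ge0 ?subr_ge0.
have /psumr_eq0P sq_eq0 : \sum_j (\sum_i adjmx R e i j - mu) ^+ 2 = 0.
  (* Used with weights [c] and points [d], then with weights 1 and the degrees as points: the
     moments of order 0, 1 and 2 agree, so the two sums of squares are equal. *)
  have sumE (a x : 'I_n -> R) : \sum_i a i * (x i - mu) ^+ 2 =
      \sum_i a i * x i ^+ 2 - 2 * mu * \sum_i a i * x i + mu ^+ 2 * \sum_i a i.
    rewrite !mulr_sumr -sumrB -big_split /=; apply: eq_bigr => i _; ring.
  have sum1 (x : 'I_n -> R) : \sum_i 1 * x i = \sum_i x i.
    by apply: eq_bigr => i _; rewrite mul1r.
  have : \sum_i c i * (d i - mu) ^+ 2 = 0.
    rewrite big1 // => i _.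
    transitivity (c i * (mu - d i) * (mu - d i)); first by ring.
    by rewrite cd_eq0 mul0r.
  rewrite sumE -cd2_sum cd_sum c_sum => cd_eq.
  have := sumE (fun=> 1) (fun j => \sum_i adjmx R e i j).
  rewrite !sum1 => ->; rewrite sumr_const card_ord.
  by rewrite [X in _ * X]exchange_big /= sum_adjmx.
move=> j; apply/eqP; rewrite -subr_eq0 -sqrf_eq0; apply/eqP.
by apply: sq_eq0 => // k _; rewrite sqr_ge0.
Qed.

(** * Recognizing balanced complete bipartite graphs, and their spectrum *)

Lemma connected_edges_gt0 (V : finType) (e : rel V) :
  (1 < #|V|)%N -> connected_graph e -> (0 < #|edges e|)%N.
Proof.
move=> /card_gt1P[x [y [_ _ xy]]] /(_ x y) /connectP[[|z p] /=].
  by move=> _ yx; rewrite yx eqxx in xy.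
case/andP=> exz _ _; apply/card_gt0P; exists [set x; z].
by apply/imset2P; exists x z; rewrite ?inE.
Qed.

(** Each neighbourhood lies in the opposite part, so both parts have at least [p] elements. Their
    sizes add up to [2p], hence both equal [p] and every neighbourhood fills the opposite part. *)
Lemma regular_bipartite_complete n p (e : rel 'I_n) :
    bipartite e -> n = (2 * p)%N ->
    (forall x, #|[set y | e x y]| = p) ->
  graph_iso e (@complete_bipartite p p).
Proof.
move=> [V1 [V2 [/set0Pn[x1 x1V] /set0Pn[x2 x2V] V12 V12T eV]]] n2p deg.
have V2E x : (x \in V2) = (x \notin V1).
  have [xV1|xV1] := boolP (x \in V1); first by rewrite (disjointFr V12).
  by have := in_setT x; rewrite -V12T inE (negPf xV1).
have N1 x : x \in V1 -> [set y | e x y] \subset V2.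
  move=> xV1; apply/subsetP => y; rewrite inE => /eV[[]//|[]].
  by rewrite V2E xV1.
have N2 x : x \in V2 -> [set y | e x y] \subset V1.
  move=> xV2; apply/subsetP => y; rewrite inE => /eV[[]|[]//].
  by move: xV2; rewrite V2E => /negPf->.
have leV2 : (p <= #|V2|)%N by rewrite -(deg x1) subset_leq_card ?N1.
have leV1 : (p <= #|V1|)%N by rewrite -(deg x2) subset_leq_card ?N2.
have cV : (#|V1| + #|V2| = p + p)%N.
  rewrite -cardsUI V12T cardsT card_ord.
  by have -> : V1 :&: V2 = set0; [apply/eqP; rewrite setI_eq0 | rewrite cards0; lia].
have cV1 : #|V1| = p by lia.
have cV2 : #|V2| = p by lia.
have eE x y : e x y = (x \in V1) (+) (y \in V1).
  have [xV1|xV1] := boolP (x \in V1).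
    have /eqP/setP/(_ y) : [set y | e x y] == V2.
      by rewrite eqEcard N1 // deg cV2 /=.
    by rewrite inE V2E.
  have /eqP/setP/(_ y) : [set y | e x y] == V1.
    by rewrite eqEcard N2 ?V2E // deg cV1 /=.
  by rewrite inE.
(* Each part is numbered by its enumeration; [x1V] and [x2V] only supply the default elements that
   [enum_rank_in] requires. *)
pose h x : 'I_p + 'I_p := if x \in V1 then inl (cast_ord cV1 (enum_rank_in x1V x))
  else inr (cast_ord cV2 (enum_rank_in x2V x)).
exists h; last first.
  by move=> x y; rewrite eE /h; case: (x \in V1); case: (y \in V1).
apply: inj_card_bij; last by rewrite card_sum !card_ord; lia.
move=> x y; rewrite /h.
have [xV1|xV1] := boolP (x \in V1); have [yV1|yV1] := boolP (y \in V1) => //.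
  by case=> /ord_inj/(enum_rank_in_inj xV1 yV1).
by case=> /ord_inj/enum_rank_in_inj->; rewrite ?V2E.
Qed.

(** A walk of length three joins only vertices on opposite sides, and its two inner vertices can
    each be chosen in [p] ways. *)
Lemma complete_bipartite_adjmx3 (R : realType) n p (e : rel 'I_n) :
    graph_iso e (@complete_bipartite p p) ->
  adjmx R e *m adjmx R e *m adjmx R e = p%:R ^+ 2 *: adjmx R e.
Proof.
case=> h [g hK gK] he; pose side x := if h x is inl _ then true else false.
have eE x y : e x y = side x (+) side y.
  by rewrite -he /side; case: (h x); case: (h y).
have countE b : \sum_z (side z (+) b)%:R = p%:R :> R.
  rewrite (reindex g) /=; last by exists h => x _; [apply: gK | apply: hK].
  rewrite big_sumType /=; case: b.
    rewrite big1 ?add0r => [|i _]; last by rewrite /side gK.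
    by under eq_bigr do rewrite /side gK; rewrite sumr_const card_ord.
  rewrite addrC big1 ?add0r => [|i _]; last by rewrite /side gK.
  by under eq_bigr do rewrite /side gK; rewrite sumr_const card_ord.
apply/matrixP => x y; rewrite !mxE.
(* The square of the matrix has entry [p] at vertices on the same side and 0 elsewhere. If [x] and
   [z] share a side, [z] differs from [y] exactly when [x] does. *)
transitivity (\sum_z p%:R * ((side x (+) side y)%:R * (side z (+) side y)%:R) : R).
  apply: eq_bigr => z _; rewrite !mxE.
  have -> : \sum_j adjmx R e x j * adjmx R e j z =
      \sum_j (~~ (side x (+) side z))%:R * (side j (+) side z)%:R.
    apply: eq_bigr => j _; rewrite !mxE !eE.
    by case: (side x); case: (side j); case: (side z); rewrite /= ?mulr0 ?mul0r.
  rewrite -mulr_sumr countE eE mulrAC mulrC; congr (_ * _).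
  by rewrite -!natrM; case: (side x); case: (side y); case: (side z).
rewrite -mulr_sumr -mulr_sumr countE eE; ring.
Qed.

Lemma eigenvalue_pow3 (F : fieldType) n (A : 'M[F]_n) (a b : F) :
  A *m A *m A = b *: A -> root (char_poly A) a -> a ^+ 3 = b * a.
Proof.
move=> A3; rewrite -eigenvalue_root_char => /eigenvalueP[v vA v0].
have : (a ^+ 3 - b * a) *: v = 0.
  rewrite scalerBl -[b * a]mulrC.
  have -> : a ^+ 3 *: v = v *m (A *m A *m A).
    by rewrite !mulmxA vA -!scalemxAl vA -!scalemxAl vA !scalerA !exprSr expr0 mul1r.
  by rewrite A3 -scalemxAr vA scalerA [a * b]mulrC subrr.
by move/eqP; rewrite scaler_eq0 (negPf v0) orbF subr_eq0 => /eqP.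
Qed.

(** No eigenvalue multiplicity has to be computed: on the possible eigenvalues 0, [p] and [-p], cosh
    agrees with a quadratic polynomial without linear term, so its sum depends only on [n] and the
    trace of the square. *)
Lemma complete_bipartite_sum_cosh (R : realType) n p (e : rel 'I_n) (d : 'I_n -> R) :
    simple_graph e -> graph_iso e (@complete_bipartite p p) -> (0 < p)%N ->
    (p ^ 2 = #|edges e|)%N ->
    char_poly (adjmx R e) = \prod_i ('X - (d i)%:P) ->
    (forall k, \tr (adjmx R e ^+ k) = \sum_i d i ^+ k) ->
  \sum_i cosh (d i) = 2 * cosh p%:R + (n%:R - 2).
Proof.
move=> e_simple e_iso p0 pm pA trA.
have p0R : p%:R != 0 :> R by rewrite pnatr_eq0 -lt0n.
have d3 i : d i ^+ 3 = p%:R ^+ 2 * d i.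
  apply: eigenvalue_pow3 (complete_bipartite_adjmx3 R e_iso) _.
  by rewrite pA (bigD1 i) //= rootM root_XsubC eqxx.
have coshE i : cosh (d i) = 1 + (cosh p%:R - 1) / p%:R ^+ 2 * d i ^+ 2.
  have : d i * ((d i - p%:R) * (d i + p%:R)) = 0.
    by transitivity (d i ^+ 3 - p%:R ^+ 2 * d i); [ring | rewrite d3 subrr].
  move/eqP; rewrite !mulf_eq0 subr_eq0 addr_eq0.
  case/or3P=> /eqP->; rewrite ?coshN ?cosh0; by field.
under eq_bigr do rewrite coshE.
rewrite big_split /= sumr_const card_ord -mulr_sumr -trA mxtrace_adjmx2 //.
by rewrite -pm natrX; field.
Qed.

Unset Implicit Arguments.
Set Strict Implicit.

Theorem theorem3 (R : realType) (n m : nat) (e : rel 'I_n)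
    (n_ge2 : (2 <= n)%N)
    (e_simple : simple_graph e)
    (e_connected : connected_graph e)
    (e_bipartite : bipartite e)
    (e_edges : #|edges e| = m) :
  estrada_index R e >= 2 * cosh (2 * m%:R / n%:R) + (n%:R - 2)
  /\ (estrada_index R e = 2 * cosh (2 * m%:R / n%:R) + (n%:R - 2)
      <-> exists p : nat,
            [/\ p%:R = Num.sqrt (m%:R : R),
                2 * Num.sqrt (m%:R : R) = n%:R
              & graph_iso e (@complete_bipartite p p)]).
Proof.
have [d [charA trA specA]] := symmetric_spectrum (tr_adjmx R e_simple).
rewrite (estrada_index_cosh e_bipartite charA).
have n0 : 0 < n%:R :> R by rewrite ltr0n; apply: leq_trans n_ge2.
have m0 : 0 < m%:R :> R.
  by rewrite ltr0n -e_edges connected_edges_gt0 ?card_ord.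
set mu : R := 2 * m%:R / n%:R.
have muE : mu * n%:R = 2 * m%:R by rewrite /mu divfK ?gt_eqF.
have mu0 : 0 < mu by rewrite !mulr_gt0 ?invr_gt0.
(* For the all-ones vector the weights sum to [n] and the weighted eigenvalues to [2m], so their
   mean is [mu]. *)
have mu_le : exists i, mu <= d i.
  have [c c0 cE] := specA (const_mx 1).
  have sc : \sum_i c i = n%:R.
    rewrite -(ones_sqnorm R n); have := cE 0%N.
    by rewrite expr0 mulmx1 => ->; apply: eq_bigr => i _; rewrite expr0 mulr1.
  apply: (weighted_sum_ge c0); rewrite sc // muE -e_edges -ones_adjmx //.
  by have := cE 1%N; rewrite expr1 => ->.
have d_sym := bipartite_spectrum e_bipartite charA.
have [cosh_ge cosh_eq] := sum_cosh_ge d_sym mu0 mu_le.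
split=> //; split=> [/cosh_eq[i [j [ij di dj d0]]]|[p [pE nE e_iso]]]; last first.
  (* Converse direction: [n = 2p] and [m = p^2] give [mu = p]. *)
  have np : n%:R = 2 * p%:R :> R by rewrite -nE pE.
  have mp : m%:R = p%:R ^+ 2 :> R by rewrite pE sqr_sqrtr ?ltW.
  have p0 : 0 < p%:R :> R by rewrite np in n0; lra.
  have -> : mu = p%:R by rewrite /mu np mp; field; rewrite gt_eqF.
  apply: (complete_bipartite_sum_cosh e_simple e_iso) => //.
    by rewrite ltr0n in p0.
  by apply/eqP; rewrite e_edges -(eqr_nat R) natrX mp.
have d_le k : d k <= mu.
  have [->|ki] := eqVneq k i; first by rewrite di.
  have [->|kj] := eqVneq k j; first by rewrite dj; lra.
  by rewrite d0 // ltW.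
have muE' : mu * n%:R = 2 * #|edges e|%:R by rewrite e_edges.
have regA := regular_of_top_eigenvalue e_simple muE' specA d_le.
(* Only the eigenvalues [mu] and [-mu] contribute to the trace of the square: [2 mu^2 = 2m]. *)
have mu2 : mu ^+ 2 = m%:R.
  have := trA 2%N; rewrite mxtrace_adjmx2 // e_edges.
  rewrite (bigD1 i) // (bigD1 j) 1?eq_sym //= di dj sqrrN.
  rewrite big1 => [|k /andP[ki kj]]; first by lra.
  by rewrite d0 // expr0n.
have n2mu : n%:R = 2 * mu.
  apply: (mulfI (lt0r_neq0 mu0)); rewrite muE -mu2; ring.
have degE x : (#|[set y | e x y]|)%:R = mu.
  rewrite -(regA x) -sum1_card natr_sum big_mkcond /=; apply: eq_bigr => y _.
  by rewrite inE mxE (proj1 e_simple); case: (e _ _).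
pose x0 : 'I_n := Ordinal (leq_trans (isT : 0 < 2)%N n_ge2).
(* The witness is the common degree, a natural number whose value in [R] is [mu], the square root of
   [m]. *)
exists #|[set y | e x0 y]|; rewrite degE.
have -> : Num.sqrt m%:R = mu by rewrite -mu2 sqrtr_sqr gtr0_norm.
split=> //; apply: regular_bipartite_complete => //.
  by apply/eqP; rewrite -(eqr_nat R) natrM degE n2mu.
by move=> x; apply/eqP; rewrite -(eqr_nat R) !degE.
Qed.
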